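(* Let $m$ and $n$ be natural numbers with $m>1$, and let $a_1,a_2,\ldots$ be an arithmetic progression of real numbers whose first term is $a_1=a$. Suppose that the sum of the first $m$ terms is zero: $a_1+\cdots+a_m=0$. Then the sum of the next $n$ terms is $$a_{m+1}+a_{m+2}+\cdots+a_{m+n}=\frac{a\,n\,(m+n)}{1-m}.$$
   Context: An arithmetic progression with difference $d$ is a sequence of real numbers satisfying $a_{k+1}=a_k+d$ for every $k$. Natural numbers are the positive integers. *)

(* Defs.v *)
From mathcomp Require Import all_boot all_order all_algebra.
From mathcomp Require Import reals.

Set Implicit Arguments.
Unset Strict Implicit.
Unset Printing Implicit Defensive.

Import Order.TTheory GRing.Theory Num.Theory.

Local Open Scope ring_scope.

(* Terms are numbered from 1, so the value of the sequence at index 0 is not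
   constrained. *)
Definition arith_progression (R : realType) (d : R) (u : nat -> R) : Prop :=
  forall k : nat, (0 < k)%N -> u k.+1 = u k + d.

(* Main.v *)
Require Import Defs.
From mathcomp Require Import all_boot all_order all_algebra.
From mathcomp Require Import reals.
From mathcomp Require Import ring lra.

Set Implicit Arguments.
Unset Strict Implicit.
Unset Printing Implicit Defensive.

Import Order.TTheory GRing.Theory Num.Theory.

Local Open Scope ring_scope.

(** Twice the sum of the first [N] terms is [N (2 a + (N - 1) d)]
    ([arith_progression_sum]). Since the first [m] terms sum to zero and [m] is
    nonzero, [2 a + (m - 1) d = 0]. The block of [n] terms after the [m]-th has
    the same sum as the first [m + n] terms, and in the formula for the latter
    the bracket [2 a + (m + n - 1) d] collapses to [n d]; hence the block sums
    to [(m + n) n d / 2], where [d / 2 = a / (1 - m)] because [m > 1]. *)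

Lemma arith_progression_nth (R : realType) (d : R) (u : nat -> R) (k : nat) :
  arith_progression d u -> u k.+1 = u 1%N + k%:R * d.
Proof.
move=> hu; elim: k => [|k IHk]; first by rewrite mul0r addr0.
by rewrite hu // IHk -natr1 mulrDl mul1r addrA.
Qed.

(** Doubling the sum keeps the closed form free of division, so that the
    induction stays within ring identities. *)
Lemma arith_progression_sum (R : realType) (d : R) (u : nat -> R) (N : nat) :
  arith_progression d u ->
  2 * \sum_(1 <= k < N.+1) u k = N%:R * (2 * u 1%N + (N%:R - 1) * d).
Proof.
move=> hu; elim: N => [|N IHN]; first by rewrite big_geq // mulr0 mul0r.
rewrite big_nat_recr //= mulrDr IHN (arith_progression_nth N hu) -natr1.
ring.
Qed.

Theorem mainTheorem2 (R : realType) (m n : nat) (a d : R) (u : nat -> R)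
    (hm : (1 < m)%N) (hn : (0 < n)%N)
    (hu : arith_progression d u) (hu1 : u 1%N = a)
    (hsum : \sum_(1 <= k < m.+1) u k = 0) :
  \sum_(m.+1 <= k < (m + n).+1) u k
    = a * n%:R * (m + n)%:R / (1 - m%:R).
Proof.
have m_gt1 : 1 < m%:R :> R by rewrite ltr1n.
have m1_neq0 : 1 - m%:R != 0 :> R by rewrite subr_eq0 lt_eqF.
have m_neq0 : m%:R != 0 :> R by rewrite gt_eqF // (lt_trans ltr01).
have first_last_opp : 2 * a + (m%:R - 1) * d = 0.
  apply: (mulfI m_neq0); rewrite mulr0 -hu1 -(arith_progression_sum m hu).
  by rewrite hsum mulr0.
have block_sum := arith_progression_sum (m + n) hu.
rewrite (@big_cat_nat _ _ _ m.+1) ?ltnS ?leq_addr //= hsum add0r hu1 in block_sum.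
apply: (mulIf m1_neq0); rewrite divfK //.
have two_neq0 : (2 : R) != 0 by rewrite pnatr_eq0.
apply: (mulfI two_neq0); rewrite mulrA block_sum natrD.
(* Eliminating [a] rather than [d] avoids dividing by [1 - m]. *)
have -> : a = (1 - m%:R) * d / 2 by lra.
by field.
Qed.
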